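(* For every positive integer $n$ and all vectors $\mathbf{a}=(a_1,\ldots,a_n)$ and $\mathbf{b}=(b_1,\ldots,b_n)$ of positive real numbers, we have $$\left(T_{\mathbf{a},\mathbf{b}}\right)^2\leq 2S_{\mathbf{a},\mathbf{b}}^{(2)}+2\sqrt{2}\,\sqrt{S_{\mathbf{a},\mathbf{b}}^{(1)}S_{\mathbf{a},\mathbf{b}}^{(3)}}.$$
   Context: For a positive integer $n$ and two vectors $\mathbf{a}=(a_1,\ldots,a_n)$ and $\mathbf{b}=(b_1,\ldots,b_n)$ of positive real numbers, define $$T_{\mathbf{a},\mathbf{b}}=\sum_{k=1}^n\frac{a_k}{b_k},\qquad S_{\mathbf{a},\mathbf{b}}^{(m)}=\sum_{k=1}^n\sum_{l=1}^n\frac{a_ka_l}{(b_k+b_l)^m}\quad\text{for } m=1,2,3.$$ *)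

(* Defs.v *)
From mathcomp Require Import all_boot all_order all_algebra.
From mathcomp Require Import reals.

Set Implicit Arguments.
Unset Strict Implicit.
Unset Printing Implicit Defensive.

Import Order.TTheory GRing.Theory Num.Theory.
Local Open Scope ring_scope.

Definition T_sum (R : realType) (n : nat) (a b : 'rV[R]_n) : R :=
  \sum_(k < n) a 0 k / b 0 k.

(* The source uses S_sum only for m = 1, 2, 3. *)
Definition S_sum (R : realType) (n : nat) (a b : 'rV[R]_n) (m : nat) : R :=
  \sum_(k < n) \sum_(l < n) (a 0 k * a 0 l) / (b 0 k + b 0 l) ^+ m.

(* Main.v *)
Require Import Defs.
From mathcomp Require Import all_boot all_order all_algebra.
From mathcomp Require Import reals.
From mathcomp Require Import ring.

(** Put f(t) = sum_k a_k exp(- b_k t). Then T is the integral of f over the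
    positive half-line, and S^(1), S^(2), 2 S^(3) are the integrals of f^2,
    t f^2 and t^2 f^2. For every r > 0, the Cauchy-Schwarz inequality applied
    to f = (r + t) f / (r + t) gives
      r T^2 <= r^2 S^(1) + 2 r S^(2) + 2 S^(3)                      (E)
    since the integral of (r + t)^-2 is 1 / r. The claim is (E) at the r that
    minimises r S^(1) + 2 S^(3) / r, namely r = sqrt (2 S^(1) S^(3)) / S^(1).

    The proof below of (E) uses no integral. Let F be the tail integral
    of f, so that F' = - f and F(0) = T. As
      ((r + t) F' + F)^2 = (r + t)^2 f^2 + d/dt ((r + t) F^2),
    the difference of the two sides of (E) is the squared L^2 norm of
    (r + t) F' + F, which has the form sum_k (c_k + d_k t) exp(- b_k t) with
    c_k = a_k (1 / b_k - r) and d_k = - a_k. In terms of b, c and d that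
    squared norm is the rational expression [exp_gram], so all that is needed
    is [exp_gram_ge0].

    The positivity of [exp_gram] is algebraic. With B(x) = (x - z) / (x + z),
      1 / (x + y) = 2 z / ((x + z) (y + z)) + B(x) B(y) / (x + y),
    so splitting off a square replaces the coefficients c_k by c_k B(b_k)
    and thus kills those for which b_k = z; running z through all the b_k
    leaves the zero form. Differentiating the identity in x and y gives its
    analogue in the presence of the d_k ([exp_gram_split]), where taking
    z = b_k kills d_k first. *)

Set Implicit Arguments.
Unset Strict Implicit.
Unset Printing Implicit Defensive.

Import Order.TTheory GRing.Theory Num.Theory.
Local Open Scope ring_scope.

(** The integral over t > 0 of the square of
    sum_k (c k + d k * t) exp(- b k * t), when all b k are positive. *)
Definition exp_gram (R : realFieldType) (I : finType) (b c d : I -> R) : R :=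
  \sum_k \sum_l (c k * c l / (b k + b l)
                 + (c k * d l + d k * c l) / (b k + b l) ^+ 2
                 + 2 * d k * d l / (b k + b l) ^+ 3).

Definition blaschke (R : realFieldType) (z x : R) : R := (x - z) / (x + z).

Definition blaschke' (R : realFieldType) (z x : R) : R := 2 * z / (x + z) ^+ 2.

Lemma blaschke_neq0 (R : realFieldType) (z x : R) : blaschke z x != 0 -> x != z.
Proof. by apply: contra_neq => ->; rewrite /blaschke subrr mul0r. Qed.

(** The square that is split off is that of the Laplace transform at z of the
    exponential polynomial: it comes from the projection on exp(- z t). The
    minus sign in the new coefficients is there because multiplication by t
    is minus the derivative in the exponent. *)
Lemma exp_gram_split (R : realFieldType) (I : finType) (b c d : I -> R) (z : R) :
    (forall k, 0 < b k) -> 0 < z ->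
  exp_gram b c d =
    2 * z * (\sum_k (c k / (b k + z) + d k / (b k + z) ^+ 2)) ^+ 2
    + exp_gram b (fun k => c k * blaschke z (b k) - d k * blaschke' z (b k))
               (fun k => d k * blaschke z (b k)).
Proof.
move=> b_gt0 z_gt0.
rewrite expr2 mulr_suml mulr_sumr /exp_gram -big_split /=; apply: eq_bigr => k _.
rewrite mulr_sumr mulr_sumr -big_split /=; apply: eq_bigr => l _.
have bk := b_gt0 k; have bl := b_gt0 l; rewrite /blaschke /blaschke'.
by field; rewrite !lt0r_neq0 ?addr_gt0.
Qed.

Lemma exp_gram_ge_blaschke (R : realFieldType) (I : finType) (b c d : I -> R)
    (z : R) : (forall k, 0 < b k) -> 0 < z ->
  exp_gram b (fun k => c k * blaschke z (b k) - d k * blaschke' z (b k))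
           (fun k => d k * blaschke z (b k)) <= exp_gram b c d.
Proof.
move=> b_gt0 z_gt0; rewrite (exp_gram_split c d b_gt0 z_gt0).
by rewrite lerDr mulr_ge0 ?sqr_ge0 // mulr_ge0 // ltW.
Qed.

Lemma eq_exp_gram (R : realFieldType) (I : finType) (b c c' d d' : I -> R) :
  c =1 c' -> d =1 d' -> exp_gram b c d = exp_gram b c' d'.
Proof.
move=> eq_c eq_d; apply: eq_bigr => k _; apply: eq_bigr => l _.
by rewrite !eq_c !eq_d.
Qed.

(** The list s is a supply of points z: each z in it kills the coefficients of
    the exponents equal to z, so that the invariant passes to the tail. *)
Lemma exp_gram_const_ge0 (R : realFieldType) (I : finType) (b c : I -> R)
    (s : seq R) : (forall k, 0 < b k) -> (forall z, z \in s -> 0 < z) ->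
    (forall k, c k != 0 -> b k \in s) ->
  0 <= exp_gram b c (fun=> 0).
Proof.
move=> b_gt0; elim: s c => [|z s IHs] c s_gt0 c_s.
  have c0 k : c k = 0 by apply/eqP/negP=> /negP/c_s.
  rewrite /exp_gram big1 // => k _; rewrite big1 // => l _.
  by rewrite !c0 !(mulr0, mul0r, addr0).
apply: le_trans (exp_gram_ge_blaschke c (fun=> 0) b_gt0 (s_gt0 z (mem_head _ _))).
rewrite (@eq_exp_gram _ _ _ _ (fun k => c k * blaschke z (b k)) _ (fun=> 0));
  [| by move=> k; rewrite mul0r subr0 | by move=> k; rewrite mul0r].
apply: IHs => [x xs|k]; first by rewrite s_gt0 // inE xs orbT.
rewrite mulf_eq0 negb_or => /andP[/c_s + /blaschke_neq0 /negPf bz].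
by rewrite inE bz.
Qed.

(** The first pass through the exponents removes all the d k, at the expense of
    changing the c k; a second pass then removes the c k. *)
Lemma exp_gram_ge0 (R : realFieldType) (I : finType) (b c d : I -> R) :
  (forall k, 0 < b k) -> 0 <= exp_gram b c d.
Proof.
move=> b_gt0.
have codom_gt0 z : z \in codom b -> 0 < z by case/codomP=> k ->.
have [s [s_gt0 d_s]] : exists s : seq R,
    (forall z, z \in s -> 0 < z) /\ (forall k, d k != 0 -> b k \in s).
  by exists (codom b); split=> // k _; exact: codom_f.
elim: s s_gt0 c d d_s => [|z s IHs] s_gt0 c d d_s.
  have d0 k : d k = 0 by apply/eqP/negP=> /negP/d_s.
  rewrite (@eq_exp_gram _ _ _ _ c _ (fun=> 0)) //.
  apply: (@exp_gram_const_ge0 _ _ _ _ (codom b)) => // k _; exact: codom_f.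
apply: le_trans (exp_gram_ge_blaschke c d b_gt0 (s_gt0 z (mem_head _ _))).
apply: IHs => [x xs|k]; first by rewrite s_gt0 // inE xs orbT.
rewrite mulf_eq0 negb_or => /andP[/d_s + /blaschke_neq0 /negPf bz].
by rewrite inE bz.
Qed.

(** This is (E): the difference of the two sides is the [exp_gram] of
    (r + t) F' + F. *)
Lemma T_sum_sqr_le (R : realType) (n : nat) (a b : 'rV[R]_n) (r : R) :
    (forall k, 0 < b 0 k) ->
  r * T_sum a b ^+ 2
    <= r ^+ 2 * S_sum a b 1 + 2 * r * S_sum a b 2 + 2 * S_sum a b 3.
Proof.
move=> b_gt0; rewrite -subr_ge0.
have := exp_gram_ge0 (fun k => a 0 k * ((b 0 k)^-1 - r)) (fun k => - a 0 k) b_gt0.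
congr (0 <= _); rewrite /T_sum /S_sum (expr2 (\sum_k _)) mulr_suml !mulr_sumr.
rewrite -!big_split -sumrB /=; apply: eq_bigr => k _.
rewrite !mulr_sumr -!big_split -sumrB /=; apply: eq_bigr => l _.
have bk := b_gt0 k; have bl := b_gt0 l.
by field; rewrite !lt0r_neq0 ?addr_gt0.
Qed.

Lemma S_sum_gt0 (R : realType) (n : nat) (a b : 'rV[R]_n) (m : nat) :
    (0 < n)%N -> (forall k, 0 < a 0 k) -> (forall k, 0 < b 0 k) ->
  0 < S_sum a b m.
Proof.
case: n a b => // n a b _ a_gt0 b_gt0.
have term_gt0 k l : 0 < a 0 k * a 0 l / (b 0 k + b 0 l) ^+ m.
  by rewrite divr_gt0 ?mulr_gt0 ?exprn_gt0 ?addr_gt0.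
rewrite /S_sum big_ord_recl ltr_pwDl //; last first.
  by apply: sumr_ge0 => k _; apply: sumr_ge0 => l _; exact: ltW.
by rewrite big_ord_recl ltr_pwDl // sumr_ge0 // => l _; exact: ltW.
Qed.

Theorem proposition2p1 (R : realType) (n : nat) (hn : (0 < n)%N)
    (a b : 'rV[R]_n)
    (ha : forall k : 'I_n, 0 < a 0 k) (hb : forall k : 'I_n, 0 < b 0 k) :
  T_sum a b ^+ 2 <=
    2 * S_sum a b 2 + 2 * Num.sqrt 2 * Num.sqrt (S_sum a b 1 * S_sum a b 3).
Proof.
have S1_gt0 := S_sum_gt0 1 hn ha hb; have S3_gt0 := S_sum_gt0 3 hn ha hb.
rewrite -(mulrA 2) -sqrtrM //.
set w := Num.sqrt _.
have w_gt0 : 0 < w by rewrite sqrtr_gt0 !mulr_gt0.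
have w2 : w ^+ 2 = 2 * (S_sum a b 1 * S_sum a b 3).
  by rewrite sqr_sqrtr // ltW // !mulr_gt0.
pose r := w / S_sum a b 1.
have r_gt0 : 0 < r by rewrite divr_gt0.
have S3E : 2 * S_sum a b 3 = r * w.
  by rewrite /r mulrAC -expr2 w2; field; rewrite lt0r_neq0.
have S1E : r * S_sum a b 1 = w by rewrite /r divfK // lt0r_neq0.
rewrite -(ler_pM2l r_gt0); apply: le_trans (T_sum_sqr_le a r hb) _.
rewrite [leLHS](_ : _ = r * (2 * S_sum a b 2 + 2 * w)) //.
by rewrite (expr2 r) -(mulrA r) S1E S3E; ring.
Qed.
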